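(* Let $T\subset\mathbb{R}^d$ be compact and let $\{W(t),t\in T\}$ be a Gaussian process with continuous sample paths, having mean function $\mu(t)$ and continuous covariance kernel $\sigma(s,t)$. Assume that $\mu$ and a (nonrandom) function $w:T\to\mathbb{R}$ belong to the RKHS of the kernel $\sigma$, in the sense defined in the context. Then $$\mathrm{P}\Big(\sup_{t\in T}|W(t)-w(t)|<\varepsilon\Big)>0\qquad\text{for all }\varepsilon>0.$$
   Context: The paper uses ''RKHS of the kernel $\sigma$'' for the closure, in the supremum metric on $T$, of the set of finite linear combinations $\big\{t\mapsto\sum_{i=1}^k a_i\sigma(t,t_i):\ k\ge1,\ a_1,\dots,a_k\in\mathbb{R},\ t_1,\dots,t_k\in T\big\}$. *)

(* Defs.v *)
From HB Require Import structures.
From mathcomp Require Import all_boot all_order all_algebra.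
From mathcomp Require Import all_classical all_reals all_analysis.

Set Implicit Arguments.
Unset Strict Implicit.
Unset Printing Implicit Defensive.

Import Order.TTheory GRing.Theory Num.Theory.
Import numFieldNormedType.Exports.

Local Open Scope classical_set_scope.
Local Open Scope ring_scope.

(* [normal_prob m 0] is the uniform law on [0, 1] in the library, so the
   degenerate normal law N(m, 0) is given separately as a Dirac mass. *)
Definition gaussian_law (R : realType) (m s : R) : set R -> \bar R :=
  if s == 0 then \d_m else normal_prob m s.

Definition is_gaussian (dO : measure_display) (Omega : measurableType dO)
    (R : realType) (P : probability Omega R) (X : Omega -> R) : Prop :=
  exists m s : R, 0 <= s /\
    forall A : set R, measurable A -> pushforward P X A = gaussian_law m s A.

(* The finite-dimensional distributions are multivariate normal, possibly
   singular: every finite linear combination is univariate normal. *)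
Definition gaussian_process (dO : measure_display) (Omega : measurableType dO)
    (R : realType) (P : probability Omega R) (I : Type)
    (W : I -> {RV P >-> R}) : Prop :=
  forall (k : nat) (a : 'I_k -> R) (t : 'I_k -> I),
    is_gaussian P (fun omega => \sum_(i < k) a i * W (t i) omega).

Definition has_mean (dO : measure_display) (Omega : measurableType dO)
    (R : realType) (P : probability Omega R) (I : Type)
    (W : I -> {RV P >-> R}) (mu : I -> R) : Prop :=
  forall t : I, 'E_P[W t]%E = (mu t)%:E.

Definition has_covariance (dO : measure_display) (Omega : measurableType dO)
    (R : realType) (P : probability Omega R) (I : Type)
    (W : I -> {RV P >-> R}) (sigma : I -> I -> R) : Prop :=
  forall s t : I, covariance P (W s) (W t) = (sigma s t)%:E.

Definition kernel_span (R : realType) (I : choiceType) (sigma : I -> I -> R)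
    : set (I -> R) :=
  [set f | exists (k : nat) (a : 'I_k -> R) (u : 'I_k -> I),
    (0 < k)%N /\ f = fun t => \sum_(i < k) a i * sigma t (u i)].

(* This is the closure of the span for uniform convergence, which is larger in
   general than the Hilbert space usually called the RKHS of sigma. *)
Definition rkhs (R : realType) (I : choiceType) (sigma : I -> I -> R)
    : set (I -> R) :=
  closure (kernel_span sigma : set {uniform I -> R}).

Lemma rkhsP (R : realType) (I : choiceType) (sigma : I -> I -> R) (f : I -> R) :
  rkhs sigma f <->
  forall e : R, 0 < e ->
    exists2 g, kernel_span sigma g &
      (ereal_sup (range (fun t => `|f t - g t|%:E)) < e%:E)%E.
Proof.
split.
- move=> cf e e0.
  have e20 : 0 < e / 2 by rewrite divr_gt0.
  have : nbhs (f : {uniform I -> R})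
      [set g : {uniform I -> R} | forall t, `|f t - g t| < e / 2].
    apply/uniform_nbhs; exists [set xy | ball xy.1 (e / 2) xy.2]; split.
      by rewrite -entourage_ballE; exists (e / 2).
    by move=> g /= fg t; exact: fg.
  move=> /cf[g [sg /= fg]]; exists g => //.
  apply: (@le_lt_trans _ _ (e / 2)%:E).
    by apply: ge_ereal_sup => _ [t _ <-]; rewrite lee_fin ltW.
  by rewrite lte_fin ltr_pdivrMr// ltr_pMr// ltr1n.
- move=> fP B /uniform_nbhs[E [entE EB]].
  move: entE; rewrite -entourage_ballE => -[e /= e0 eE].
  have [g sg fg] := fP _ e0.
  exists g; split=> //; apply: EB => t _; apply: eE => /=.
  rewrite /ball/= -lte_fin; apply: le_lt_trans fg.
  by apply: ereal_sup_ubound; exists t.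
Qed.

(* Main.v *)
(** The function [w - mu] is uniformly close to a combination
    [h = sum_j a_j sigma(., u_j)], which is the covariance of [W] with
    [Y = sum_j a_j W(u_j)].  By the Cameron-Martin formula the law of [W + h] has the
    density [exp (Y - E Y - Var Y / 2)] with respect to the law of [W], so it is enough
    that [W] stays close to [mu] with positive probability.  If [W'] is an independent
    copy of [W], then [(W - W') / sqrt 2 + mu] has the law of [W], and it is close to
    [mu] as soon as [W] and [W'] are close to each other.  The latter has positive
    probability: on a compact space countably many step functions approximate all
    continuous paths, so the path of [W] is close to one of them with positive
    probability.

    Equality of laws is obtained without characteristic functions: the functionals of
    the path with equal expectations contain the exponentials of linear combinations
    and are stable under dominated limits, and the indicators of cylinder sets are
    reached from exponentials by such limits. *)

Require Import Defs.
From HB Require Import structures.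
From mathcomp Require Import all_boot all_order all_algebra.
From mathcomp Require Import all_classical all_reals all_analysis.
From mathcomp Require Import measurable_realfun.
From mathcomp Require Import ring lra.

Set Implicit Arguments.
Unset Strict Implicit.
Unset Printing Implicit Defensive.

Import Order.TTheory GRing.Theory Num.Theory.
Import numFieldNormedType.Exports.

Local Open Scope classical_set_scope.
Local Open Scope ring_scope.

(** * Dominated closure of a class of functions *)

Section dominated_closure.
Context {R : realType} {S : Type}.
Implicit Types (E : set (S -> R)) (f g : S -> R).

(* The dominating function of a limit must itself lie in the closure, so that its
   integrability comes by induction. *)
Inductive dominated_closure E : (S -> R) -> Prop :=
| dclosure_base f : E f -> dominated_closure E f
| dclosure_lin (a : R) f g : dominated_closure E f -> dominated_closure E g ->
    dominated_closure E (fun s => a * f s + g s)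
| dclosure_lim (f_ : nat -> S -> R) f g :
    (forall n, dominated_closure E (f_ n)) -> dominated_closure E g ->
    (forall n s, `|f_ n s| <= g s) ->
    (forall s, f_ n s @[n --> \oo] --> f s) -> dominated_closure E f.

End dominated_closure.

Section integral_dominated_closure.
Local Open Scope ereal_scope.
Context {R : realType} {S : Type} (E : set (S -> R)).

Lemma dominated_convergence_EFin d (T : measurableType d)
    (m : {measure set T -> \bar R}) (f_ : nat -> T -> R) (f g : T -> R) :
  (forall n, m.-integrable [set: T] (EFin \o f_ n)) ->
  m.-integrable [set: T] (EFin \o g) ->
  (forall n x, `|f_ n x| <= g x)%R -> (forall x, f_ n x @[n --> \oo] --> f x)%R ->
  m.-integrable [set: T] (EFin \o f) /\
  \int[m]_x (f_ n x)%:E @[n --> \oo] --> \int[m]_x (f x)%:E.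
Proof.
move=> if_ ig f_g f_f.
have mf_ n : measurable_fun [set: T] (f_ n).
  exact/measurable_EFinP/(measurable_int m).
have [] := @dominated_convergence _ _ _ m _ measurableT
  (fun n => EFin \o f_ n) (EFin \o f) (EFin \o g) => //.
- by move=> n; exact/measurable_EFinP.
- exact/measurable_EFinP/(measurable_fun_cvg mf_).
- by apply/aeW => x _; apply/fine_cvgP; split; [exact: nearW|exact: f_f].
- by apply/aeW => x n _; rewrite lee_fin.
Qed.

Section integrability.
Context d (T : measurableType d) (m : {measure set T -> \bar R}).
Variables (phi : T -> S) (rho : T -> R).
Hypothesis rho_ge0 : forall x, (0 <= rho x)%R.

Local Notation weighted f := (fun x => (f (phi x) * rho x)%:E).

Hypothesis integrable_base : forall f, E f -> m.-integrable [set: T] (weighted f).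

Lemma integral_weighted_lin (a : R) (f g : S -> R) :
  m.-integrable [set: T] (weighted f) -> m.-integrable [set: T] (weighted g) ->
  m.-integrable [set: T] (weighted (fun s => a * f s + g s)%R) /\
  \int[m]_x weighted (fun s => a * f s + g s)%R x =
    a%:E * (\int[m]_x weighted f x) + \int[m]_x weighted g x.
Proof.
move=> if_ ig.
have -> : weighted (fun s => a * f s + g s)%R =
    (fun x => a%:E * weighted f x + weighted g x).
  by apply/funext => x; rewrite -EFinM -EFinD mulrDl mulrA.
have iaf : m.-integrable [set: T] (fun x => a%:E * weighted f x) by exact: integrableZl.
by split; [exact: integrableD|rewrite integralD// integralZl].
Qed.

Lemma dominated_convergence_weighted (f_ : nat -> S -> R) (f g : S -> R) :
  (forall n, m.-integrable [set: T] (weighted (f_ n))) ->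
  m.-integrable [set: T] (weighted g) ->
  (forall n s, `|f_ n s| <= g s)%R -> (forall s, f_ n s @[n --> \oo] --> f s)%R ->
  m.-integrable [set: T] (weighted f) /\
  \int[m]_x weighted (f_ n) x @[n --> \oo] --> \int[m]_x weighted f x.
Proof.
move=> if_ ig f_g f_f; apply: (dominated_convergence_EFin if_ ig) => [n x|x].
  by rewrite normrM (ger0_norm (rho_ge0 x)) ler_wpM2r.
by apply: cvgM; [exact: f_f|exact: cvg_cst].
Qed.

Lemma integrable_dominated_closure f :
  dominated_closure E f -> m.-integrable [set: T] (weighted f).
Proof.
elim=> {f} [|a f g _ if_ _ ig|f_ f g _ if_ _ ig f_g f_f]; first exact: integrable_base.
- exact: (integral_weighted_lin a if_ ig).1.
- exact: (dominated_convergence_weighted if_ ig f_g f_f).1.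
Qed.

End integrability.

Section equality.
Context d1 d2 (T1 : measurableType d1) (T2 : measurableType d2).
Variables (m1 : {measure set T1 -> \bar R}) (m2 : {measure set T2 -> \bar R}).
Variables (phi1 : T1 -> S) (phi2 : T2 -> S) (rho1 : T1 -> R) (rho2 : T2 -> R).
Hypotheses (rho1_ge0 : forall x, (0 <= rho1 x)%R)
  (rho2_ge0 : forall x, (0 <= rho2 x)%R).
Hypothesis integrable_base1 :
  forall f, E f -> m1.-integrable [set: T1] (fun x => (f (phi1 x) * rho1 x)%:E).
Hypothesis integrable_base2 :
  forall f, E f -> m2.-integrable [set: T2] (fun x => (f (phi2 x) * rho2 x)%:E).
Hypothesis eq_integral_base : forall f, E f ->
  \int[m1]_x (f (phi1 x) * rho1 x)%:E = \int[m2]_x (f (phi2 x) * rho2 x)%:E.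

Lemma eq_integral_dominated_closure f : dominated_closure E f ->
  \int[m1]_x (f (phi1 x) * rho1 x)%:E = \int[m2]_x (f (phi2 x) * rho2 x)%:E.
Proof.
have int1 := integrable_dominated_closure rho1_ge0 integrable_base1.
have int2 := integrable_dominated_closure rho2_ge0 integrable_base2.
elim=> {f} [|a f g Ef eqf Eg eqg|f_ f g Ef_ eqf_ Eg _ f_g f_f].
- exact: eq_integral_base.
- have [_ ->] := integral_weighted_lin a (int1 _ Ef) (int1 _ Eg).
  by have [_ ->] := integral_weighted_lin a (int2 _ Ef) (int2 _ Eg); rewrite eqf eqg.
- have [_ cvg1] := dominated_convergence_weighted rho1_ge0
    (fun n => int1 _ (Ef_ n)) (int1 _ Eg) f_g f_f.
  have [_ cvg2] := dominated_convergence_weighted rho2_ge0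
    (fun n => int2 _ (Ef_ n)) (int2 _ Eg) f_g f_f.
  by apply: (cvg_unique _ cvg1) => //; rewrite (funext eqf_).
Qed.

End equality.
End integral_dominated_closure.

(** * Approximation of the sign by polynomials and exponentials *)

Section real_approximation.
Context {R : realType}.
Implicit Types x y : R.

Lemma expR_sub1_le x : expR x - 1 <= x * expR x.
Proof.
have := ler_wpM2r (expR_ge0 x) (expR_ge1Dx (- x)).
by rewrite -expRD addNr expR0 mulrBl mul1r; lra.
Qed.

Lemma expR_norm_le x : expR `|x| <= expR x + expR (- x).
Proof.
have := expR_ge0 x; have := expR_ge0 (- x).
by case: (ger0P x) => _; lra.
Qed.

Lemma norm_expR_sub1_le x : `|expR x - 1| <= `|x| * expR `|x|.
Proof.
have [x0|x0] := leP 0 x.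
  rewrite (ger0_norm x0) ger0_norm ?expR_sub1_le//.
  by rewrite subr_ge0 -expR0 ler_expR.
rewrite (ltr0_norm x0) ler0_norm; last first.
  by rewrite subr_le0 -expR0 ler_expR ltW.
rewrite opprB (@le_trans _ _ (- x))//.
  by have := expR_ge1Dx x; lra.
by rewrite ler_peMr ?oppr_ge0 ?ltW// -expR0 ltr_expR oppr_gt0.
Qed.

Lemma cvg_scaled_expR_sub1 x :
  n.+1%:R * (expR (x / n.+1%:R) - 1) @[n --> \oo] --> x.
Proof.
have xn0 : x / n.+1%:R @[n --> \oo] --> (0 : R).
  by rewrite -(mulr0 x); apply: cvgM; [exact: cvg_cst|exact: cvg_harmonic].
apply: (@squeeze_cvgr _ _ _ _ (fun=> x) (fun n => x * expR (x / n.+1%:R))).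
- apply: nearW => n; apply/andP; split.
    by rewrite -ler_pdivrMl// mulrC lerBrDl expR_ge1Dx.
  by rewrite -ler_pdivlMl// mulrA [_^-1 * x]mulrC expR_sub1_le.
- exact: cvg_cst.
- rewrite -[X in _ --> X]mulr1 -[X in x * X](@expR0 R).
  apply: cvgM; first exact: cvg_cst.
  by apply: (cvg_comp _ expR xn0); exact: continuous_expR.
Qed.

Lemma norm_scaled_expR_sub1_le n x :
  `|n.+1%:R * (expR (x / n.+1%:R) - 1)| <= expR (2 * `|x|).
Proof.
set y := x / n.+1%:R.
have xy : `|x| = n.+1%:R * `|y| by rewrite normrM [`|_^-1|]ger0_norm// mulrC divfK.
have yx : `|y| <= `|x| by rewrite xy ler_peMl// ler1n.
rewrite normrM normr_nat.
rewrite (le_trans (ler_wpM2l _ (norm_expR_sub1_le y)))// mulrA -xy.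
rewrite mulr_natl mulr2n expRD; apply: ler_pM; rewrite ?expR_ge0 ?ler_expR//.
by have := expR_ge1Dx `|x|; lra.
Qed.

Lemma norm_series_sin_coeff x n : `|series (sin_coeff x) n| <= expR `|x|.
Proof.
have le_n : `|series (sin_coeff x) n| <= series (exp_coeff `|x|) n.
  rewrite /series/= (le_trans (ler_norm_sum _ _ _))// ler_sum// => i _.
  rewrite /sin_coeff /exp_coeff/= !normrM normfV !normrX normrN1 expr1n mulr1.
  rewrite !normr_nat -mulrA ler_piMl ?divr_ge0 ?exprn_ge0//.
  by rewrite -[leRHS]/(1%:R) ler_nat leq_b1.
apply: (le_trans le_n); apply: nondecreasing_cvgn_le.
  by apply/nondecreasing_series => k _ _; exact: exp_coeff_ge0.
exact: is_cvg_series_exp_coeff.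
Qed.

Lemma sin_gt0_norm_lt_pi x : `|x| < pi -> (0 < sin x) = (0 < x).
Proof.
rewrite ltr_norml => /andP[Npix xpi].
have [x0|x0|->] := ltgtP x 0; last by rewrite sin0 ltxx.
  apply/negbTE; rewrite -leNgt -oppr_ge0 -sinN ltW// sin_gt0_pi// oppr_gt0 x0/=.
  by rewrite ltrNl.
by rewrite sin_gt0_pi// x0.
Qed.

(* The iteration for [sqrt (y ^+ 2)] from the usual proof of Stone-Weierstrass. *)
Definition norm_iter y n : R := iter n (fun q => q + (y ^+ 2 - q ^+ 2) / 2) 0.

Lemma norm_iter_bounds y n : `|y| <= 1 ->
  `|y| - (1 - `|y| / 2) ^+ n <= norm_iter y n <= `|y| /\ 0 <= norm_iter y n.
Proof.
move=> y1; elim: n => [|n [/andP[qlo qhi] q0]].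
  by rewrite expr0 /= subr_le0 y1 normr_ge0.
rewrite /norm_iter iterS -/(norm_iter y n); set q := norm_iter y n in qlo qhi q0 *.
have z0 := normr_ge0 y; rewrite -(real_normK (num_real y)) exprSr.
set z := `|y| in y1 z0 qlo qhi *; set p := (1 - z / 2) ^+ n in qlo *.
have step_ge : p * (1 - z / 2) >= (z - q) * (1 - (z + q) / 2).
  by apply: ler_pM; lra.
have step_le : 0 <= (z - q) * (1 - (z + q) / 2) by apply: mulr_ge0; lra.
have q_incr : 0 <= (z - q) * (z + q) by apply: mulr_ge0; lra.
by split; [apply/andP; split|]; nra.
Qed.

Lemma cvg_norm_iter y : `|y| <= 1 -> norm_iter y n @[n --> \oo] --> `|y|.
Proof.
move=> y1; have [y0|y0] := eqVneq y 0.
  apply: cvg_near_cst; apply: nearW => n; apply/eqP; rewrite eq_le.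
  have [/andP[_ ->] q0] := norm_iter_bounds n y1.
  by rewrite y0 normr0 -[X in norm_iter X]y0.
apply: (@squeeze_cvgr _ _ _ _ (fun n => `|y| - (1 - `|y| / 2) ^+ n) (fun=> `|y|)).
- by apply: nearW => n; have [] := norm_iter_bounds n y1.
- rewrite -[X in _ --> X]subr0; apply: cvgB; first exact: cvg_cst.
  apply: cvg_expr; have : 0 < `|y| by rewrite normr_gt0.
  by move=> ?; rewrite ger0_norm; lra.
- exact: cvg_cst.
Qed.

End real_approximation.

(** * The dominated closure of a multiplicative class *)

Section dominated_closure_majorant.
Context {R : realType} {S : Type} (E : set (S -> R)).
Hypothesis E_ge0 : forall f, E f -> forall s, 0 <= f s.

Lemma dclosure_majorant f : dominated_closure E f ->
  exists2 g, dominated_closure E g & forall s, `|f s| <= g s.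
Proof.
elim=> {f} [f Ef|a f g _ [f' Ef' ff'] _ [g' Eg' gg']|f_ f g Ef_ _ Eg _ f_g f_f].
- by exists f => [|s]; [exact: dclosure_base|rewrite ger0_norm ?E_ge0].
- exists (fun s => `|a| * f' s + g' s) => [|s]; first exact: dclosure_lin.
  by rewrite (le_trans (ler_normD _ _))// normrM lerD ?ler_wpM2l.
- exists g => // s.
  by apply: (cvgr_to_le (cvg_norm (f_f s))); apply: nearW => n; exact: f_g.
Qed.

End dominated_closure_majorant.

Section multiplicative_class.
Context {R : realType} {S : Type} (E : set (S -> R)).
Hypotheses (E_ge0 : forall f, E f -> forall s, 0 <= f s) (E_one : E (fun=> 1)).
Hypothesis E_mul : forall f g, E f -> E g -> E (fun s => f s * g s).
Implicit Types (f g : S -> R) (A B : set S).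

Local Notation dc := (dominated_closure E).

Lemma dclosureM_base f g : dc f -> E g -> dc (fun s => f s * g s).
Proof.
move=> + Eg; elim=> {f} [f Ef|a f h _ fg _ hg|f_ f h _ fg_ Eh hg f_h f_f].
- exact/dclosure_base/E_mul.
- rewrite (_ : (fun s => _) = (fun s => a * (f s * g s) + h s * g s)).
    exact: dclosure_lin.
  by apply/funext => s; rewrite mulrDl mulrA.
- apply: (dclosure_lim fg_ hg) => [n s|s]; last by apply: cvgM => //; exact: cvg_cst.
  by rewrite normrM (ger0_norm (E_ge0 Eg _)) ler_wpM2r// E_ge0.
Qed.

Lemma dclosureM f g : dc f -> dc g -> dc (fun s => f s * g s).
Proof.
move=> + Eg; elim: Eg f => {g} [g Eg|a g h _ fg _ fh|g_ g h _ fg_ Eh fh g_h g_g] f Ef.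
- exact: dclosureM_base.
- rewrite (_ : (fun s => _) = (fun s => a * (f s * g s) + f s * h s)).
    by apply: dclosure_lin; [exact: fg|exact: fh].
  by apply/funext => s; rewrite mulrDr mulrCA.
- have [f' Ef' ff'] := dclosure_majorant E_ge0 Ef.
  apply: (dclosure_lim (fun n => fg_ n f Ef) (fh _ Ef')) => [n s|s].
    by rewrite normrM ler_pM.
  by apply: cvgM => //; exact: cvg_cst.
Qed.

Lemma dclosure_cst (c : R) : dc (fun=> c).
Proof.
rewrite (_ : (fun=> c) = fun=> (c - 1) * 1 + 1).
  by apply: dclosure_lin; exact: dclosure_base.
by apply/funext => s; rewrite mulr1 subrK.
Qed.

Lemma dclosureZ (a : R) f : dc f -> dc (fun s => a * f s).
Proof. by apply: dclosureM; exact: dclosure_cst. Qed.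

Lemma dclosureD f g : dc f -> dc g -> dc (fun s => f s + g s).
Proof.
move=> df dg; rewrite (_ : (fun s => _) = fun s => 1 * f s + g s).
  exact: dclosure_lin.
by apply/funext => s; rewrite mul1r.
Qed.

Lemma dclosureB f g : dc f -> dc g -> dc (fun s => f s - g s).
Proof.
move=> df dg; rewrite (_ : (fun s => _) = fun s => -1 * g s + f s).
  exact: dclosure_lin.
by apply/funext => s; rewrite mulN1r addrC.
Qed.

Lemma dclosureX n f : dc f -> dc (fun s => f s ^+ n).
Proof.
move=> df; elim: n => [|n IH]; first exact: dclosure_cst.
rewrite (_ : (fun s => _) = fun s => f s * f s ^+ n); first exact: dclosureM.
by apply/funext => s; rewrite exprS.
Qed.

Lemma dclosure_sum n (f : nat -> S -> R) : (forall i, dc (f i)) ->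
  dc (fun s => \sum_(0 <= i < n) f i s).
Proof.
move=> df; elim: n => [|n IH].
  rewrite (_ : (fun s => _) = fun=> 0); first exact: dclosure_cst.
  by apply/funext => s; rewrite big_nil.
rewrite (_ : (fun s => _) = fun s => (\sum_(0 <= i < n) f i s) + f n s).
  exact: dclosureD.
by apply/funext => s; rewrite big_nat_recr.
Qed.

Lemma dclosure_bounded_lim (c : R) (f_ : nat -> S -> R) f : (forall n, dc (f_ n)) ->
  (forall n s, `|f_ n s| <= c) -> (forall s, f_ n s @[n --> \oo] --> f s) -> dc f.
Proof. by move=> df_ f_c f_f; exact: (dclosure_lim df_ (dclosure_cst c)). Qed.

Lemma dclosure_norm f : dc f -> (forall s, `|f s| <= 1) -> dc (fun s => `|f s|).
Proof.
move=> df f1; apply: (@dclosure_bounded_lim 1 (fun n s => norm_iter (f s) n)).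
- elim=> [|n IH]; first exact: dclosure_cst.
  rewrite (_ : (fun s => _) = fun s => norm_iter (f s) n +
    2^-1 * (f s ^+ 2 - norm_iter (f s) n ^+ 2)).
    by apply/dclosureD/dclosureZ/dclosureB; [|exact: dclosureX..].
  by apply/funext => s; rewrite /norm_iter iterS mulrC.
- move=> n s; have [/andP[_ q1] q0] := norm_iter_bounds n (f1 s).
  by rewrite ger0_norm// (le_trans q1).
- by move=> s; exact: cvg_norm_iter.
Qed.

Lemma norm_indic_le1 A s : `|\1_A s : R| <= 1.
Proof. by rewrite indicE normr_nat -[leRHS]/(1%:R) ler_nat leq_b1. Qed.

Lemma dclosure_indic_setC A : dc \1_A -> dc \1_(~` A).
Proof.
move=> dA; rewrite (_ : \1__ = fun s => 1 - \1_A s).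
  by apply: dclosureB => //; exact: dclosure_cst.
by apply/funext => s; rewrite !indicE in_setC; case: (_ \in _); rewrite ?subrr ?subr0.
Qed.

Lemma dclosure_indic_setI A B : dc \1_A -> dc \1_B -> dc \1_(A `&` B).
Proof. by move=> dA dB; rewrite indicI; exact: dclosureM. Qed.

Lemma dclosure_indic_lim (A_ : nat -> set S) A : (forall n, dc \1_(A_ n)) ->
  (forall s, \forall n \near \oo, A_ n s <-> A s) -> dc \1_A.
Proof.
move=> dA A_A; apply: (dclosure_bounded_lim dA) => [n s|s]; first exact: norm_indic_le1.
apply: cvg_near_cst; have := A_A s; apply: filterS => n nA.
by rewrite !indicE (_ : (s \in A_ n) = (s \in A))//; apply/idP/idP; rewrite !inE => /nA.
Qed.

Lemma dclosure_indic_bigcap (A : nat -> set S) :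
  (forall n, dc \1_(A n)) -> dc \1_(\bigcap_n A n).
Proof.
move=> dA; apply: (@dclosure_indic_lim (fun n => \bigcap_(i < n) A i)) => [|s].
  elim=> [|n IH]; first by rewrite bigcap_mkord big_ord0 indicT; exact: dclosure_cst.
  by rewrite bigcap_mkord big_ord_recr/= -bigcap_mkord; exact: dclosure_indic_setI.
have [As|] := pselect ((\bigcap_n A n) s).
  by apply: nearW => n; split=> // _ i _; exact: As.
move=> /existsNP[N /not_implyP[_ NAs]]; exists N.+1 => // n /= Nn; split=> As.
  by have := NAs (As N Nn).
by have := NAs (As N Logic.I).
Qed.

(* The powers of [1 - f^+] decrease to the indicator of [f <= 0]. *)
Lemma dclosure_indic_gt0 f : dc f -> (forall s, `|f s| <= 1) ->
  dc \1_[set s | 0 < f s].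
Proof.
move=> df f1; pose p s := 1 - 2^-1 * (f s + `|f s|).
have p01 s : 0 <= p s <= 1.
  by rewrite /p; have := f1 s; case: (ger0P (f s)) => *; apply/andP; split; lra.
rewrite (_ : [set s | 0 < f s] = ~` [set s | f s <= 0]); last first.
  by apply/seteqP; split=> s /=; rewrite ltNge => /negP.
apply: dclosure_indic_setC; apply: (@dclosure_bounded_lim 1 (fun n s => p s ^+ n)).
- move=> n; apply: dclosureX; apply: dclosureB; first exact: dclosure_cst.
  by apply/dclosureZ/dclosureD => //; exact: dclosure_norm.
- by move=> n s; have /andP[p0 p1] := p01 s; rewrite normrX ger0_norm// exprn_ile1.
move=> s; rewrite indicE; have [fs0|fs0] := leP (f s) 0.
  rewrite mem_set//=; apply: cvg_near_cst; apply: nearW => n.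
  by rewrite /p ler0_norm// subrr mulr0 subr0 expr1n.
rewrite memNset/=; last by apply/negP; rewrite -ltNge.
apply: cvg_expr; have /andP[p0 _] := p01 s.
by rewrite ger0_norm// /p gtr0_norm//; lra.
Qed.

Lemma dclosure_exp_id f : (forall a, dc (fun s => expR (a * f s))) -> dc f.
Proof.
move=> dexp; pose f_ n s := n.+1%:R * (expR (f s / n.+1%:R) - 1).
apply: (@dclosure_lim _ _ _ f_ _ (fun s => expR (2 * f s) + expR (- 2 * f s))).
- move=> n; apply/dclosureZ/dclosureB; last exact: dclosure_cst.
  by under eq_fun do rewrite mulrC.
- exact: dclosureD.
- move=> n s; rewrite mulNr (le_trans _ (expR_norm_le _))//.
  by rewrite [`|2 * _|]normrM normr_nat norm_scaled_expR_sub1_le.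
- by move=> s; exact: cvg_scaled_expR_sub1.
Qed.

Lemma dclosure_exp_sin f : (forall a, dc (fun s => expR (a * f s))) ->
  dc (fun s => sin (f s)).
Proof.
move=> dexp; have df := dclosure_exp_id dexp.
apply: (@dclosure_lim _ _ _ (fun n s => series (sin_coeff (f s)) n) _
  (fun s => expR (1 * f s) + expR (- 1 * f s))).
- move=> n; apply: dclosure_sum => i; rewrite /sin_coeff/=.
  under eq_fun do rewrite mulrAC.
  exact/dclosureZ/dclosureX.
- exact: dclosureD.
- move=> n s; rewrite (le_trans (norm_series_sin_coeff _ _))//.
  by rewrite mulN1r mul1r expR_norm_le.
- by move=> s; rewrite unlock; exact: is_cvg_series_sin_coeff.
Qed.

(* [sin (f / n.+1)] is bounded and eventually has the sign of [f]. *)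
Lemma dclosure_exp_indic_gt0 f : (forall a, dc (fun s => expR (a * f s))) ->
  dc \1_[set s | 0 < f s].
Proof.
move=> dexp.
apply: (@dclosure_indic_lim (fun n => [set s | 0 < sin (f s / n.+1%:R)])) => [n|s].
  apply: dclosure_indic_gt0 => [|s]; last first.
    by rewrite ler_norml sin_geN1 sin_le1.
  by apply: dclosure_exp_sin => a; under eq_fun do rewrite mulrCA mulrC.
exists (Num.bound `|f s|) => // n /= bound_n.
rewrite sin_gt0_norm_lt_pi; first by rewrite pmulr_lgt0 ?invr_gt0.
rewrite (@lt_le_trans _ _ 1)//; last by rewrite (le_trans _ (pi_ge2 R))// ler1n.
rewrite normrM normfV normr_nat ltr_pdivrMr// mul1r.
by rewrite (lt_le_trans (archi_boundP _))// ler_nat ltnW.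
Qed.

End multiplicative_class.

(** * Processes with the same exponential moments have the same law *)

Definition lincomb {R : pzRingType} {I : Type} (c : seq (R * I)) (F : I -> R) : R :=
  \sum_(p <- c) p.1 * F p.2.

Section lincomb_theory.
Context {R : comPzRingType} {I : Type}.
Implicit Types (c : seq (R * I)) (F G : I -> R).

Lemma lincomb_nil F : lincomb [::] F = 0.
Proof. exact: big_nil. Qed.

Lemma lincomb_cons p c F : lincomb (p :: c) F = p.1 * F p.2 + lincomb c F.
Proof. exact: big_cons. Qed.

Lemma lincomb_cat c1 c2 F : lincomb (c1 ++ c2) F = lincomb c1 F + lincomb c2 F.
Proof. exact: big_cat. Qed.

Lemma lincomb_scale (a : R) c F :
  lincomb [seq (a * p.1, p.2) | p <- c] F = a * lincomb c F.
Proof.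
by rewrite /lincomb big_map mulr_sumr; apply: eq_bigr => p _ /=; rewrite mulrA.
Qed.

Lemma lincombD c F G : lincomb c (fun t => F t + G t) = lincomb c F + lincomb c G.
Proof. by rewrite -big_split; apply: eq_bigr => p _; rewrite mulrDr. Qed.

Lemma lincombB c F G : lincomb c (fun t => F t - G t) = lincomb c F - lincomb c G.
Proof. by rewrite -sumrB; apply: eq_bigr => p _; rewrite mulrBr. Qed.

Lemma lincombZ c (a : R) F : lincomb c (fun t => a * F t) = a * lincomb c F.
Proof. by rewrite mulr_sumr; apply: eq_bigr => p _; rewrite mulrCA. Qed.

Lemma lincomb_ord k (a : 'I_k -> R) (t : 'I_k -> I) F :
  lincomb [seq (a i, t i) | i <- enum 'I_k] F = \sum_(i < k) a i * F (t i).
Proof. by rewrite /lincomb big_map big_enum. Qed.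

End lincomb_theory.

Section cylinder.
Context {R : realType} {I : Type}.

Definition half_spaces : set (set (I -> R)) :=
  [set A | exists t r, A = [set s : I -> R | r < s t]].

Definition cylinder : set (set (I -> R)) := <<s half_spaces >>.

Definition exp_lincombs : set ((I -> R) -> R) :=
  [set f | exists c, f = fun s => expR (lincomb c s)].

Lemma exp_lincombs_ge0 f : exp_lincombs f -> forall s, 0 <= f s.
Proof. by move=> [c ->] s; exact: expR_ge0. Qed.

Lemma exp_lincombs_one : exp_lincombs (fun=> 1).
Proof. by exists [::]; apply/funext => s; rewrite lincomb_nil expR0. Qed.

Lemma exp_lincombsM f g :
  exp_lincombs f -> exp_lincombs g -> exp_lincombs (fun s => f s * g s).
Proof.
by move=> [b ->] [c ->]; exists (b ++ c); apply/funext => s; rewrite lincomb_cat expRD.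
Qed.

Local Notation dc := (dominated_closure exp_lincombs).

Lemma dclosure_half_space (t : I) (r : R) : dc \1_[set s | r < s t].
Proof.
rewrite (_ : [set s | _] = [set s | 0 < s t - r]); last first.
  by apply/seteqP; split=> s /=; rewrite subr_gt0.
apply: (dclosure_exp_indic_gt0 exp_lincombs_ge0 exp_lincombs_one exp_lincombsM) => a.
rewrite (_ : (fun s => _) = fun s => expR (- (a * r)) * expR (lincomb [:: (a, t)] s)).
  apply: (dclosureZ exp_lincombs_ge0 exp_lincombs_one exp_lincombsM).
  by apply: dclosure_base; exists [:: (a, t)].
by apply/funext => s; rewrite lincomb_cons lincomb_nil addr0 -expRD mulrBr addrC.
Qed.

Lemma dclosure_cylinder (A : set (I -> R)) : cylinder A -> dc \1_A.
Proof.
have dcC B := @dclosure_indic_setC _ _ _ exp_lincombs_one B.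
have dcI := dclosure_indic_bigcap exp_lincombs_ge0 exp_lincombs_one exp_lincombsM.
move: A; apply: smallest_sub => [|_ [t [r ->]]]; last exact: dclosure_half_space.
split=> [|A dA|A dA] /=.
- by rewrite -setCT; apply: dcC; rewrite indicT; exact: dclosure_cst exp_lincombs_one 1.
- by rewrite setTD; exact: dcC.
- by rewrite -[\bigcup_k _]setCK setC_bigcup; apply/dcC/dcI => n; exact: dcC.
Qed.

Lemma measurable_cylinder d (T : measurableType d) (X : T -> I -> R)
    (A : set (I -> R)) :
  (forall t, measurable_fun [set: T] (X ^~ t)) -> cylinder A ->
  measurable [set x | A (X x)].
Proof.
move=> mX; rewrite -[X in measurable X]setTI.
have : @measurable_fun _ _ T (g_sigma_algebraType half_spaces) [set: T] X.
  apply: (@measurability _ _ _ (g_sigma_algebraType half_spaces) _ _ half_spaces) => //.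
  move=> _ [_ [t [r ->]] <-].
  rewrite setTI (_ : _ @^-1` _ = [set: T] `&` (X ^~ t) @^-1` `]r, +oo[).
    by apply: mX => //; exact: measurable_itv.
  by rewrite setTI; apply/seteqP; split=> x /=; rewrite in_itv/= andbT.
by move=> /[apply]; exact.
Qed.

Definition seq_ball (D : nat -> I) (w : I -> R) (r : R) : set (I -> R) :=
  [set s | forall n, `|s (D n) - w (D n)| <= r].

Lemma cylinder_seq_ball (D : nat -> I) (w : I -> R) (r : R) :
  cylinder (seq_ball D w r).
Proof.
pose pathT := g_sigma_algebraType half_spaces.
have mcoord (t : I) : measurable_fun [set: pathT] (fun s : pathT => s t).
  apply: (measurability _ (RGenOInfty.measurableE R)) => // _ [_ [x ->] <-].
  rewrite setTI; apply: sub_sigma_algebra; exists t, x.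
  by apply/seteqP; split=> s /=; rewrite in_itv/= andbT.
rewrite (_ : seq_ball D w r = \bigcap_n ([set: pathT] `&`
    (fun s : pathT => `|s (D n) - w (D n)|) @^-1` `]-oo, r])).
  apply: (@bigcapT_measurable _ pathT) => n.
  have : measurable_fun [set: pathT] (fun s : pathT => `|s (D n) - w (D n)|).
    by apply: measurableT_comp => //; apply: measurable_funB => //; exact: mcoord.
  by apply => //; exact: measurable_itv.
apply/seteqP; split=> s /= ball_s n; first by move=> _; split=> //=; rewrite in_itv/=.
by have [_ /=] := ball_s n Logic.I; rewrite in_itv.
Qed.

Lemma measurable_seq_ball d (T : measurableType d) (X : T -> I -> R)
    (D : nat -> I) (w : I -> R) (r : R) :
  (forall t, measurable_fun [set: T] (X ^~ t)) ->
  measurable [set x | seq_ball D w r (X x)].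
Proof. by move=> mX; apply: measurable_cylinder mX _; exact: cylinder_seq_ball. Qed.

End cylinder.

Section measurable_lincomb.
Context {R : realType} {I : Type} d (T : measurableType d) (X : T -> I -> R).
Hypothesis mX : forall t, measurable_fun [set: T] (X ^~ t).

Lemma measurable_lincomb c : measurable_fun [set: T] (fun x => lincomb c (X x)).
Proof. by apply: measurable_sum => p; exact: measurable_funM. Qed.

Lemma measurable_expR_lincomb c :
  measurable_fun [set: T] (fun x => expR (lincomb c (X x))).
Proof. by apply: measurableT_comp => //; exact: measurable_lincomb. Qed.

End measurable_lincomb.

Section law_of_exponential_moments.
Local Open Scope ereal_scope.
Context {R : realType} {I : Type}.
Context d1 d2 (T1 : measurableType d1) (T2 : measurableType d2).
Variables (m1 : {measure set T1 -> \bar R}) (m2 : {measure set T2 -> \bar R}).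
Variables (X1 : T1 -> I -> R) (X2 : T2 -> I -> R) (rho : T1 -> R).
Hypotheses (mX1 : forall t, measurable_fun [set: T1] (X1 ^~ t))
  (mX2 : forall t, measurable_fun [set: T2] (X2 ^~ t)).
Hypotheses (rho_ge0 : forall x, (0 <= rho x)%R) (mrho : measurable_fun [set: T1] rho).
Hypothesis exp_moments_lty :
  forall c, \int[m2]_y (expR (lincomb c (X2 y)))%:E < +oo.
Hypothesis eq_exp_moments : forall c,
  \int[m1]_x (expR (lincomb c (X1 x)) * rho x)%:E =
  \int[m2]_y (expR (lincomb c (X2 y)))%:E.

Lemma law_of_exp_moments (A : set (I -> R)) : cylinder A ->
  \int[m1]_x (\1_A (X1 x) * rho x)%:E = m2 [set y | A (X2 y)].
Proof.
move=> cylA; have mA := measurable_cylinder mX2 cylA.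
rewrite (@eq_integral_dominated_closure _ _ exp_lincombs _ _ _ _ m1 m2 X1 X2 rho
  (fun=> 1%R))//; last exact: dclosure_cylinder.
- under eq_integral do rewrite mulr1.
  by rewrite -[X in _ = m2 X]setIT -integral_indic.
- move=> _ [c ->]; apply/integrableP; split.
    by apply/measurable_EFinP/measurable_funM => //; exact: measurable_expR_lincomb.
  under eq_integral do rewrite /= ger0_norm ?mulr_ge0 ?expR_ge0//.
  by rewrite eq_exp_moments.
- move=> _ [c ->]; under eq_fun do rewrite mulr1.
  apply/integrableP; split; first exact/measurable_EFinP/measurable_expR_lincomb.
  by under eq_integral do rewrite /= ger0_norm ?expR_ge0//.
- by move=> _ [c ->]; rewrite eq_exp_moments; under [RHS]eq_integral do rewrite mulr1.
Qed.

End law_of_exponential_moments.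

(** * Moment generating functions of Gaussian variables *)

Lemma norm_exprM_expR_le (R : realType) n (a x : R) :
  `|x ^+ n * expR (a * x)| <= n`!%:R * expR ((1 + `|a|) * `|x|).
Proof.
rewrite normrM normrX (ger0_norm (expR_ge0 _)) mulrDl mul1r expRD mulrA.
apply: ler_pM; rewrite ?exprn_ge0 ?expR_ge0//; last first.
  by rewrite ler_expR (le_trans (ler_norm _))// normrM.
case: n => [|n]; first by rewrite expr0 fact0 mul1r -[leLHS]expR0 ler_expR.
rewrite -ler_pdivrMl ?ltr0n ?fact_gt0// mulrC.
by rewrite (le_trans _ (expR_ge1Dxn n (normr_ge0 x)))// lerDr.
Qed.

Section tilted_moments.
Local Open Scope ereal_scope.
Context {R : realType} d (T : measurableType d) (P : probability T R).
Variable X : T -> R.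
Hypothesis mX : measurable_fun [set: T] X.

Lemma mmt_gen_funE a : 'M_P X a = \int[P]_x (expR (a * X x))%:E.
Proof.
rewrite /mmt_gen_fun unlock; apply: eq_integral => x _.
by rewrite /= mulrC.
Qed.

Hypothesis mgf_lty : forall a, 'M_P X a < +oo.

Lemma integrable_expRM a : P.-integrable [set: T] (EFin \o (fun x => expR (a * X x))).
Proof.
apply/integrableP; split.
  by apply/measurable_EFinP; apply: measurableT_comp => //; exact: measurable_funM.
under eq_integral do rewrite /= ger0_norm ?expR_ge0//.
by rewrite -mmt_gen_funE.
Qed.

Lemma integrable_expRM_norm a :
  P.-integrable [set: T] (EFin \o (fun x => expR (a * `|X x|))).
Proof.
have iG := integrableD measurableT (integrable_expRM a) (integrable_expRM (- a)).
apply: le_integrable iG => //.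
  apply/measurable_EFinP; apply: measurableT_comp => //; apply: measurable_funM => //.
  exact: measurableT_comp.
move=> x _; rewrite lee_fin [leLHS]ger0_norm ?expR_ge0//.
rewrite [leRHS]ger0_norm ?addr_ge0 ?expR_ge0//.
by case: (ger0P (X x)) => _; rewrite ?mulrN ?mulNr ?lerDl ?lerDr expR_ge0.
Qed.

Lemma integrable_exprM_expR n a :
  P.-integrable [set: T] (EFin \o (fun x => X x ^+ n * expR (a * X x))%R).
Proof.
have iG := integrableZl measurableT (n`!%:R) (integrable_expRM_norm (1 + `|a|)%R).
apply: le_integrable iG => //.
  apply/measurable_EFinP; apply: measurable_funM; first exact: measurable_funX.
  by apply: measurableT_comp => //; exact: measurable_funM.
move=> x _; rewrite lee_fin [leRHS]ger0_norm ?mulr_ge0 ?expR_ge0//.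
exact: norm_exprM_expR_le.
Qed.

Definition tilted_moment n a : R := \int[P]_x (X x ^+ n * expR (a * X x)).

Lemma integrable_moment n : P.-integrable [set: T] (EFin \o (fun x => X x ^+ n)%R).
Proof.
have := integrable_exprM_expR n 0.
by under eq_fun do rewrite mul0r expR0 mulr1.
Qed.

Lemma integral_moment n : \int[P]_x (X x ^+ n)%:E = (tilted_moment n 0)%:E.
Proof.
rewrite /tilted_moment /Rintegral.
under [in RHS]eq_integral do rewrite mul0r expR0 mulr1.
by rewrite fineK//; exact/integrable_fin_num/integrable_moment.
Qed.

Lemma derive1_tilted_moment n a : derive1 (tilted_moment n) a = tilted_moment n.+1 a.
Proof.
pose f b x : R := (X x ^+ n * expR (b * X x))%R.
have df (b : R) x : is_derive b (1%R : R) (f ^~ x) (X x ^+ n.+1 * expR (b * X x))%R.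
  by apply: is_derive_eq; rewrite /GRing.scale/= exprS; ring.
pose G x : R := (n.+1`!%:R * expR ((2 + `|a|) * `|X x|))%R.
rewrite (@differentiation_under_integral _ _ _ P f setT measurableT
  a (a - 1) (a + 1) _ _ _ G).
- apply: eq_Rintegral => x _; rewrite /partial1of2 derive1E.
  exact: (@derive_val _ _ _ _ _ _ _ (df a x)).
- by rewrite /= in_itv/=; lra.
- by move=> b _; exact: integrable_exprM_expR.
- by move=> b x _ _; case: (df b x).
- by move=> x; rewrite mulr_ge0 ?expR_ge0.
- exact: (integrableZl measurableT _ (integrable_expRM_norm _)).
- move=> b x; rewrite /= in_itv/= => /andP[ab ba] _.
  rewrite /partial1of2 derive1E (@derive_val _ _ _ _ _ _ _ (df b x)).
  rewrite (le_trans (norm_exprM_expR_le _ _ _))// ler_wpM2l// ler_expR ler_wpM2r//.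
  have : (`|b| <= `|a| + `|b - a|)%R by rewrite -{1}(subrKC a b) ler_normD.
  have : (`|b - a| <= 1)%R by rewrite ler_norml; lra.
  by lra.
Qed.

End tilted_moments.

Lemma integrable_sqr_Lfun2 d (T : measurableType d) (R : realType)
    (m : {measure set T -> \bar R}) (f : T -> R) :
  measurable_fun [set: T] f ->
  m.-integrable [set: T] (EFin \o (fun x => f x ^+ 2)) -> f \in Lfun m 2%:E.
Proof.
move=> mf /integrableP[_ f2].
rewrite inE; apply/andP; split; rewrite inE//=.
rewrite /finite_norm unlock poweR_lty//.
apply: le_lt_trans f2; rewrite le_eqVlt; apply/orP; left; apply/eqP.
by apply: eq_integral => x _ /=; rewrite powR_mulrn// normrX.
Qed.

Section normal_mgf.
Context {R : realType}.
Implicit Types m v s a : R.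

Definition normal_mgf m v a : R := expR (a * m + a ^+ 2 * v / 2).

Lemma derive1_normal_mgf m v a :
  derive1 (normal_mgf m v) a = (m + a * v) * normal_mgf m v a.
Proof.
rewrite derive1E.
have dM : is_derive a (1 : R) (normal_mgf m v) ((m + a * v) * normal_mgf m v a).
  by apply: is_derive_eq; rewrite /GRing.scale/= /normal_mgf; field.
exact: derive_val.
Qed.

Lemma derive1_linear_normal_mgf m v :
  derive1 (fun a => (m + a * v) * normal_mgf m v a) 0 = v + m ^+ 2.
Proof.
rewrite derive1E.
have dM : is_derive (0 : R) (1 : R)
    (fun a => (m + a * v) * normal_mgf m v a) (v + m ^+ 2).
  apply: is_derive_eq; rewrite /GRing.scale/= /normal_mgf expr0n/= !mul0r !addr0.
  by rewrite expR0; field.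
exact: derive_val.
Qed.

Section normal_mgf_moments.
Context d (T : measurableType d) (P : probability T R) (X : T -> R) (m v : R).
Hypotheses (mX : measurable_fun [set: T] X)
  (mgfX : forall a, 'M_P X a = (normal_mgf m v a)%:E).

Let mgf_lty a : ('M_P X a < +oo)%E. Proof. by rewrite mgfX ltry. Qed.

Lemma tilted_moment0 : tilted_moment P X 0 = normal_mgf m v.
Proof.
apply/funext => a; rewrite /tilted_moment /Rintegral.
under eq_integral do rewrite expr0 mul1r.
by rewrite -mmt_gen_funE mgfX.
Qed.

Lemma tilted_moment1 : tilted_moment P X 1 = fun a => (m + a * v) * normal_mgf m v a.
Proof.
apply/funext => a; rewrite -derive1_normal_mgf -tilted_moment0.
by rewrite derive1_tilted_moment.
Qed.

Lemma tilted_moment2 : tilted_moment P X 2 0 = v + m ^+ 2.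
Proof.
by rewrite -derive1_linear_normal_mgf -tilted_moment1 derive1_tilted_moment.
Qed.

Lemma normal_mgf_Lfun2 : X \in Lfun P 2%:E.
Proof. by apply: integrable_sqr_Lfun2 => //; exact: integrable_moment. Qed.

Lemma normal_mgf_expectation : ('E_P[X] = m%:E)%E.
Proof.
have := integral_moment mX mgf_lty 1; rewrite tilted_moment1 mul0r addr0 /normal_mgf.
by rewrite mul0r expr0n/= !mul0r addr0 expR0 mulr1 unlock.
Qed.

Lemma normal_mgf_variance : ('V_P[X] = v%:E)%E.
Proof.
rewrite varianceE ?normal_mgf_Lfun2// normal_mgf_expectation unlock.
rewrite -[LHS]/((\int[P]_x (X x ^+ 2)%:E - m%:E ^+ 2)%E).
by rewrite integral_moment// tilted_moment2 -EFin_expe -EFinB addrK.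
Qed.

End normal_mgf_moments.

Local Notation mu := (@lebesgue_measure R).

(* [normal_prob] is a measure on [measurableTypeR R], whose display differs from
   the one of [R]. *)
Lemma ge0_integral_normal_prob m s (f : R -> \bar R) :
  (forall x, 0 <= f x)%E -> measurable_fun [set: R] f ->
  (\int[normal_prob m s]_x f x = \int[mu]_x (f x * (normal_pdf m s x)%:E))%E.
Proof.
move=> f0 mf.
have dom : normal_prob m s `<< mu := @normal_prob_dominates R m s.
rewrite -(Radon_Nikodym_SigmaFinite.change_of_variables dom)//.
have ir : mu.-integrable [set: R] (Radon_Nikodym_SigmaFinite.f (normal_prob m s) mu).
  exact: Radon_Nikodym_SigmaFinite.f_integrable.
apply: ae_eq_integral => //.
- by apply: emeasurable_funM => //; exact: measurable_int ir.
- apply: emeasurable_funM => //; apply: measurableT_comp => //.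
  exact: measurable_normal_pdf.
- apply: ae_eqe_mul2l; apply: integral_ae_eq => //.
  + by apply: measurableT_comp => //; exact: measurable_normal_pdf.
  + by move=> A _ mA; rewrite -Radon_Nikodym_SigmaFinite.f_integral.
Qed.

Lemma integral_normal_prob_expR m s a : s != 0 ->
  (\int[normal_prob m s]_x (expR (a * x))%:E = (normal_mgf m (s ^+ 2) a)%:E)%E.
Proof.
move=> s0; rewrite ge0_integral_normal_prob; last 2 first.
- by move=> x; rewrite lee_fin expR_ge0.
- by apply/measurable_EFinP; apply: measurableT_comp => //; exact: measurable_funM.
rewrite -[RHS]mule1 -[X in (_ * X)%E](integral_normal_pdf (m + a * s ^+ 2) s).
rewrite -(integralZl measurableT (integrable_normal_pdf _ _)).
apply: eq_integral => x _; rewrite -!EFinM; congr EFin.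
rewrite !normal_pdfE// /normal_fun mulrCA [RHS]mulrCA; congr (_ * _).
by rewrite -!expRD; congr expR; field.
Qed.

Section gaussian_variable.
Context d (T : measurableType d) (P : probability T R) (X : T -> R).
Hypotheses (mX : measurable_fun [set: T] X) (gX : is_gaussian P X).

Lemma gaussian_normal_mgf : exists m v, forall a, 'M_P X a = (normal_mgf m v a)%:E.
Proof.
case: gX => m [s [s0 lawX]]; exists m, (s ^+ 2) => a.
have me : measurable_fun [set: measurableTypeR R] (fun x => (expR (a * x))%:E).
  by apply/measurable_EFinP; apply: measurableT_comp => //; exact: measurable_funM.
have := @ge0_integral_pushforward _ _ _ (measurableTypeR R) R X mX P setT _
  measurableT me.
rewrite mmt_gen_funE preimage_setT => /(_ (fun x _ => expR_ge0 _)) <-.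
move: lawX; rewrite /gaussian_law; case: eqVneq => [->|sN0] lawX.
  rewrite (eq_measure_integral (\d_(m : measurableTypeR R)))/=; last first.
    by move=> A mA _; exact: lawX.
  by rewrite integral_dirac// diracT mul1e /normal_mgf expr0n/= mulr0 mul0r addr0.
rewrite -(integral_normal_prob_expR m a sN0).
by apply: eq_measure_integral => A mA _; exact: lawX.
Qed.

Lemma gaussian_Lfun2 : X \in Lfun P 2%:E.
Proof. by have [m [v /(normal_mgf_Lfun2 mX)]] := gaussian_normal_mgf. Qed.

Lemma gaussian_mgf a : 'M_P X a = (normal_mgf (fine 'E_P[X]) (fine 'V_P[X]) a)%:E.
Proof.
have [m [v mgfX]] := gaussian_normal_mgf.
by rewrite (normal_mgf_expectation mX mgfX) (normal_mgf_variance mX mgfX).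
Qed.

End gaussian_variable.
End normal_mgf.

(** * Moments of linear combinations *)

Section lincomb_moments.
Local Open Scope ereal_scope.
Context d (T : measurableType d) (R : realType) (P : probability T R).
Context (I : Type) (X : I -> T -> R).
Hypothesis X_Lfun2 : forall t, X t \in Lfun P 2%:E.
Implicit Type c : seq (R * I).

Local Notation lincombX c := (fun x => lincomb c (X ^~ x)).

Let Pfin : P [set: T] \is a fin_num := fin_num_measure P _ measurableT.

Let lincombX_nil : lincombX [::] = cst 0%R.
Proof. by apply/funext => x; rewrite lincomb_nil. Qed.

Let lincombX_cons p c : lincombX (p :: c) = (p.1 \o* X p.2 \+ lincombX c)%R.
Proof. by apply/funext => x; rewrite lincomb_cons /= mulrC. Qed.

Lemma lincomb_Lfun2 c : lincombX c \in Lfun P 2%:E.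
Proof.
elim: c => [|p c IH]; first by rewrite lincombX_nil Lfun_cst.
by rewrite lincombX_cons rpredD ?lee1n//= => _; rewrite Lfun_scale// ler1n.
Qed.

Lemma expectation_lincomb c (m : I -> R) : (forall t, 'E_P[X t] = (m t)%:E) ->
  'E_P[lincombX c] = (lincomb c m)%:E.
Proof.
move=> EX; elim: c => [|p c IH].
  by rewrite lincombX_nil expectation_cst lincomb_nil.
have X1 t := Lfun_subset12 Pfin (X_Lfun2 t).
rewrite lincombX_cons expectationD ?Lfun_scale//; last first.
  exact: (Lfun_subset12 Pfin (lincomb_Lfun2 c)).
by rewrite expectationZl// EX IH lincomb_cons EFinD EFinM.
Qed.

Lemma covariance_lincombl c (Z : T -> R) (k : I -> R) : Z \in Lfun P 2%:E ->
  (forall t, covariance P (X t) Z = (k t)%:E) ->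
  covariance P (lincombX c) Z = (lincomb c k)%:E.
Proof.
move=> Z2 covXZ; elim: c => [|p c IH].
  by rewrite lincombX_nil covariance_cst_l lincomb_nil.
rewrite lincombX_cons covarianceDl ?lincomb_Lfun2//; last by rewrite Lfun_scale// ler1n.
rewrite covarianceZl ?Lfun2_mul_Lfun1 ?(Lfun_subset12 Pfin)//.
by rewrite covXZ IH lincomb_cons EFinD EFinM.
Qed.

End lincomb_moments.

(** * Gaussian processes *)

Lemma integral_expRD_cst d (T : measurableType d) (R : realType)
    (m : {measure set T -> \bar R}) (f : T -> R) (e : R) :
  measurable_fun [set: T] f ->
  (\int[m]_x (expR (f x + e))%:E = (\int[m]_x (expR (f x))%:E) * (expR e)%:E)%E.
Proof.
move=> mf; under eq_integral do rewrite expRD EFinM.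
rewrite ge0_integralZr ?lee_fin ?expR_ge0//.
by apply/measurable_EFinP; exact: measurableT_comp.
Qed.

Lemma ge0_integral_prodM d1 d2 (T1 : measurableType d1) (T2 : measurableType d2)
    (R : realType) (m1 : {sigma_finite_measure set T1 -> \bar R})
    (m2 : {sigma_finite_measure set T2 -> \bar R}) (f : T1 -> R) (g : T2 -> R) :
  (forall x, 0 <= f x) -> (forall y, 0 <= g y) ->
  measurable_fun [set: T1] f -> measurable_fun [set: T2] g ->
  (\int[m1 \x m2]_z (f z.1 * g z.2)%:E =
   (\int[m1]_x (f x)%:E) * (\int[m2]_y (g y)%:E))%E.
Proof.
move=> f0 g0 mf mg.
rewrite (fubini_tonelli1 (fun z : T1 * T2 => (f z.1 * g z.2)%:E)); last 2 first.
- apply/measurable_EFinP; apply: measurable_funM.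
    exact: measurableT_comp.
  exact: measurableT_comp.
- by move=> z; rewrite lee_fin mulr_ge0.
rewrite /fubini_F /=.
under eq_integral => x _.
  under eq_integral do rewrite EFinM.
  rewrite ge0_integralZl//; last 3 first.
  - exact/measurable_EFinP.
  - by move=> y _; rewrite lee_fin.
  - by rewrite lee_fin.
  over.
rewrite ge0_integralZr//; first exact/measurable_EFinP.
- by move=> x _; rewrite lee_fin.
- by apply: integral_ge0 => y _; rewrite lee_fin.
Qed.

Definition kernel_comb {R : pzRingType} {I : Type} (sigma : I -> I -> R)
    (a : seq (R * I)) : I -> R :=
  fun t => lincomb a (sigma t).

Section gaussian_process.
Context d (T : measurableType d) (R : realType) (P : probability T R).
Context (I : Type) (W : I -> {RV P >-> R}) (mu : I -> R) (sigma : I -> I -> R).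
Hypotheses (gW : gaussian_process W) (mW : has_mean W mu)
  (cW : has_covariance W sigma).
Implicit Types (a b c : seq (R * I)) (A : set (I -> R)).

Local Notation lincombW c := (fun x => lincomb c (W ^~ x)).
Local Notation kcomb := (kernel_comb sigma).

Lemma gaussian_lincomb c : is_gaussian P (lincombW c).
Proof.
have := gW (fun i => (tnth (in_tuple c) i).1) (fun i => (tnth (in_tuple c) i).2).
rewrite (_ : (fun x => _) = lincombW c)//.
by apply/funext => x; rewrite /lincomb [RHS]big_tnth.
Qed.

Let measurable_lincombW c : measurable_fun [set: T] (lincombW c).
Proof. exact: measurable_lincomb. Qed.

Lemma gaussian_process_Lfun2 t : (W t : T -> R) \in Lfun P 2%:E.
Proof.
have := gaussian_Lfun2 (measurable_lincombW _) (gaussian_lincomb [:: (1, t)]).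
by under eq_fun do rewrite lincomb_cons lincomb_nil mul1r addr0.
Qed.

Lemma covariance_lincomb_kernel b c :
  covariance P (lincombW b) (lincombW c) = (lincomb b (kcomb c))%:E.
Proof.
have L2 := gaussian_process_Lfun2.
apply: covariance_lincombl => [//||t]; first exact: lincomb_Lfun2.
rewrite covarianceC; apply: covariance_lincombl => // s.
by rewrite covarianceC; exact: cW.
Qed.

Lemma lincomb_kernel_combC b c : lincomb b (kcomb c) = lincomb c (kcomb b).
Proof. by apply: EFin_inj; rewrite -!covariance_lincomb_kernel covarianceC. Qed.

Lemma lincomb_mgf c q :
  'M_P (lincombW c) q = (normal_mgf (lincomb c mu) (lincomb c (kcomb c)) q)%:E.
Proof.
rewrite (gaussian_mgf (measurable_lincombW c) (gaussian_lincomb c)).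
rewrite (expectation_lincomb gaussian_process_Lfun2 c mW).
by rewrite [variance _ _]covariance_lincomb_kernel.
Qed.

Lemma lincomb_exp_moment c : (\int[P]_x (expR (lincomb c (W ^~ x)))%:E =
  (expR (lincomb c mu + lincomb c (kcomb c) / 2))%:E)%E.
Proof.
have := lincomb_mgf c 1; rewrite mmt_gen_funE /normal_mgf expr1n !mul1r => <-.
by under [RHS]eq_integral do rewrite mul1r.
Qed.

Lemma lincomb_shift_exp_moment c (h : I -> R) :
  (\int[P]_x (expR (lincomb c (fun t => W t x + h t)))%:E =
   (expR (lincomb c mu + lincomb c (kcomb c) / 2 + lincomb c h))%:E)%E.
Proof.
under eq_integral do rewrite lincombD.
rewrite integral_expRD_cst; last exact: measurable_lincombW.
by rewrite lincomb_exp_moment -EFinM -expRD.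
Qed.

Section cameron_martin.
Variable a : seq (R * I).

Definition cameron_martin_density (x : T) : R :=
  expR (lincomb a (W ^~ x) - (lincomb a mu + lincomb a (kcomb a) / 2)).

Lemma measurable_cameron_martin_density :
  measurable_fun [set: T] cameron_martin_density.
Proof. by apply: measurableT_comp => //; exact: measurable_funB. Qed.

Lemma cameron_martin_exp_moment c :
  (\int[P]_x (expR (lincomb c (W ^~ x)) * cameron_martin_density x)%:E =
   \int[P]_x (expR (lincomb c (fun t => W t x + kcomb a t)))%:E)%E.
Proof.
under eq_integral do rewrite -expRD addrA -lincomb_cat.
rewrite integral_expRD_cst; last exact: measurable_lincombW.
rewrite lincomb_exp_moment lincomb_shift_exp_moment -EFinM -expRD.
have kcomb_cat t : kcomb (c ++ a) t = kcomb c t + kcomb a t by exact: lincomb_cat.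
rewrite !lincomb_cat (funext kcomb_cat) !lincombD (lincomb_kernel_combC a c).
by congr (expR _)%:E; lra.
Qed.

Lemma cameron_martin A : cylinder A ->
  (\int[P]_x (\1_A (W ^~ x) * cameron_martin_density x)%:E =
   P [set x | A (fun t => W t x + kcomb a t)%R])%E.
Proof.
apply: law_of_exp_moments => [t|t|x||c|c] //.
- exact: measurable_funD.
- exact: expR_ge0.
- exact: measurable_cameron_martin_density.
- by rewrite lincomb_shift_exp_moment ltry.
- exact: cameron_martin_exp_moment.
Qed.

Lemma kernel_shift_gt0 A : cylinder A ->
  (0 < P [set x | A (fun t => W t x + kcomb a t)%R])%E ->
  (0 < P [set x | A (W ^~ x)])%E.
Proof.
move=> cylA; rewrite -(cameron_martin cylA) !lt0e measure_ge0 andbT => /andP[+ _].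
apply: contra_neq => PA0.
have mA : measurable [set x | A (W ^~ x)] by exact: measurable_cylinder.
rewrite (_ : (fun x => _) =
    (fun x => (cameron_martin_density x)%:E) \_ [set x | A (W ^~ x)]).
  rewrite -integral_mkcond null_set_integral//.
  exact/measurable_funTS/measurable_EFinP/measurable_cameron_martin_density.
apply/funext => x; rewrite patchE indicE.
rewrite (_ : (x \in _) = (W ^~ x \in A)).
  by case: ifP; rewrite ?mul1r ?mul0r.
by apply/idP/idP; rewrite !inE.
Qed.

End cameron_martin.

Definition symmetrized (z : T * T) : I -> R :=
  fun t => (Num.sqrt 2)^-1 * (W t z.1 - W t z.2) + mu t.

Lemma lincomb_symmetrized c z : lincomb c (symmetrized z) =
  (Num.sqrt 2)^-1 * lincomb c (W ^~ z.1) - (Num.sqrt 2)^-1 * lincomb c (W ^~ z.2)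
  + lincomb c mu.
Proof. by rewrite lincombD lincombZ lincombB mulrBr. Qed.

Lemma measurable_symmetrized t : measurable_fun [set: T * T] (symmetrized ^~ t).
Proof.
apply: measurable_funD => //; apply: measurable_funM => //; apply: measurable_funB.
- exact: (measurableT_comp (measurable_funP (W t)) measurable_fst).
- exact: (measurableT_comp (measurable_funP (W t)) measurable_snd).
Qed.

Lemma symmetrized_exp_moment c :
  (\int[P \x P]_z (expR (lincomb c (symmetrized z)))%:E =
   \int[P]_x (expR (lincomb c (W ^~ x)))%:E)%E.
Proof.
pose q : R := (Num.sqrt 2)^-1; pose M e (x : T) := expR (e * lincomb c (W ^~ x)).
have M_ge0 e x : 0 <= M e x by exact: expR_ge0.
have mM e : measurable_fun [set: T] (M e).
  by apply: measurableT_comp => //; exact: measurable_funM.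
have mqW e (f : T * T -> T) : measurable_fun setT f ->
    measurable_fun [set: T * T] (fun z => e * lincomb c (W ^~ (f z))).
  move=> mf; apply: measurable_funM => //.
  exact: (measurableT_comp (measurable_lincombW c) mf).
under eq_integral do rewrite lincomb_symmetrized.
rewrite integral_expRD_cst; last by apply: measurable_funB; exact: mqW.
under eq_integral do rewrite expRD -mulNr -/(M q _) -/(M (- q) _).
rewrite (@ge0_integral_prodM _ _ _ _ _ P P (M q) (M (- q)))//.
rewrite -!mmt_gen_funE !lincomb_mgf lincomb_exp_moment -!EFinM -!expRD.
congr (expR _)%:E; rewrite sqrrN exprVn sqr_sqrtr//; lra.
Qed.

Lemma law_symmetrized A : cylinder A ->
  P [set x | A (W ^~ x)] = (P \x P)%E [set z | A (symmetrized z)].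
Proof.
move=> cylA.
rewrite -(@law_of_exp_moments _ _ _ _ _ _ P (P \x P)%E (fun x => W ^~ x)
  symmetrized (fun=> 1))//.
- under eq_integral do rewrite mulr1.
  rewrite -[X in P X]setIT -integral_indic//.
  exact: measurable_cylinder.
- exact: measurable_symmetrized.
- by move=> c; rewrite symmetrized_exp_moment lincomb_exp_moment ltry.
- by move=> c; rewrite symmetrized_exp_moment; under eq_integral do rewrite mulr1.
Qed.

Lemma seq_ball_mean_gt0 (D : nat -> I) (g : I -> R) (r : R) :
  (0 < P [set x | seq_ball D g r (W ^~ x)])%E ->
  (0 < P [set x | seq_ball D mu (2 * r) (W ^~ x)])%E.
Proof.
set E := [set x | seq_ball D g r (W ^~ x)] => PE.
have mE : measurable E by exact: measurable_seq_ball.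
rewrite law_symmetrized; last exact: cylinder_seq_ball.
apply: (@lt_le_trans _ _ ((P \x P)%E (E `*` E))).
  by rewrite product_measure1E// mule_gt0.
apply: le_measure; rewrite ?inE.
- exact: measurableX.
- exact: measurable_seq_ball measurable_symmetrized.
move=> [x y] [/= Ex Ey] n; rewrite /symmetrized/= addrK normrM.
have sqrt2_ge1 : 1 <= Num.sqrt (2 : R) by rewrite -[leLHS]sqrtr1 ler_wsqrtr// ler1n.
rewrite ger0_norm ?invr_ge0 ?sqrtr_ge0// (@le_trans _ _ `|W (D n) x - W (D n) y|)//.
  by rewrite ler_piMl// invf_le1// (lt_le_trans ltr01).
have := Ex n; have := Ey n; rewrite !ler_norml => /andP[? ?] /andP[? ?].
by apply/andP; split; lra.
Qed.

End gaussian_process.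

(** * Countable covers of the space of continuous paths *)

Lemma countable_cover_measure_gt0 d (T : measurableType d) (R : realType)
    (m : {measure set T -> \bar R}) (C : countType) (F : C -> set T) :
  (forall c, measurable (F c)) -> (forall x, exists c, F c x) ->
  (0 < m [set: T])%E -> exists c, (0 < m (F c))%E.
Proof.
move=> mF F_cover; apply: contraPP => /forallNP F0.
have F_negligible c : m.-negligible (F c).
  by apply/negligibleP => //; apply/eqP; rewrite -measure_le0 leNgt; exact/negP/F0.
have : m.-negligible (\bigcup_k (if unpickle k is Some c then F c else set0)).
  by apply: negligible_bigcup => k; case: unpickle => //; exact: negligible_set0.
rewrite (_ : \bigcup_k _ = setT); last first.
  apply/seteqP; split=> // x _; have [c Fcx] := F_cover x.
  by exists (pickle c) => //; rewrite pickleK.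
by move=> /(negligibleP m measurableT) ->; rewrite ltxx.
Qed.

Lemma compact_set_type (X : topologicalType) (A : set X) :
  compact A -> compact [set: A].
Proof.
move=> cA F PF _.
have [|x [Ax xF]] := cA (set_val @ F) _.
  by apply: (@filterS _ F _ setT) => [a _ /=|]; [exact: set_valP|exact: filterT].
have xA : x \in A by rewrite inE.
exists (exist _ x xA); split => // B C FB /= nC.
move: nC => [_ [[V oV <-] /= Vx VC]].
have [|y [[a Ba <-] Va]] := xF (set_val @` B) V _ (open_nbhs_nbhs (conj oV Vx)).
  by apply: (@filterS _ F _ B) => // a Ba /=; exists a.
by exists a; split => //; exact: VC.
Qed.

Lemma compact_second_countable_set_type (R : realType) (X : pseudoMetricType R)
    (A : set X) : compact A -> @second_countable A.
Proof.
move=> /compact_set_type cA.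
have [[x _]|A0] := pselect (exists x : A, True).
  pose Y := HB.pack_for (pseudoPMetricType R) (set_type A)
    (isPointed.Build (set_type A) x).
  exact: (@compact_second_countable R Y cA).
exists set0; first exact: countable0.
by split => // x; exfalso; apply: A0; exists x.
Qed.

Section second_countable.
Context {X : topologicalType}.

Definition base_seq (U : nat -> set X) :=
  forall x V, nbhs x V -> exists n, [/\ open (U n), U n x & U n `<=` V].

Lemma second_countable_base_seq : @second_countable X -> exists U, base_seq U.
Proof.
move=> [B /pcard_surjP[U BU] [oB nB]]; exists U => x V xV.
have [W [BW Wx] WV] := nB x V xV.
by have [n _ nW] := BU W BW; exists n; rewrite nW; split=> //; exact: oB.
Qed.

Lemma second_countable_dense_seq (x0 : X) :
  @second_countable X -> exists D : nat -> X, dense (range D).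
Proof.
move=> /second_countable_base_seq[U U_base].
have /choice[D UD] n : exists x, U n !=set0 -> U n x.
  by have [[x Ux]|Un] := pselect (U n !=set0); [exists x|exists x0 => /Un].
exists D => O [x Ox] oO.
have [n [_ Ux UO]] := U_base x O (open_nbhs_nbhs (conj oO Ox)).
by exists (D n); split; [apply/UO/UD; exists x|exists n].
Qed.

End second_countable.

Lemma dense_range_le (R : realType) (X : topologicalType) (D : nat -> X)
    (f : X -> R) (r : R) : dense (range D) -> continuous f ->
  (forall n, f (D n) <= r) -> forall x, f x <= r.
Proof.
move=> D_dense cf fD x; rewrite leNgt; apply/negP => rfx.
have [|y [/= rfy [n _ Dny]]] := D_dense [set y | r < f y] (ex_intro _ x rfx).
  by apply: (@open_comp _ _ f [set z | r < z]) => [y _|]; [exact: cf|exact: open_gt].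
by move: rfy; rewrite -Dny ltNge fD.
Qed.

Section step_paths.
Context {R : realType} {X : topologicalType}.
Variable U : nat -> set X.
Hypothesis U_base : base_seq U.

Definition step_path (l : seq (nat * rat)) (x : X) : R :=
  foldr (fun p y => if x \in U p.1 then ratr p.2 else y) 0 l.

Lemma step_path_close (l : seq (nat * rat)) (f : X -> R) (eta : R) (x : X) :
  (forall p, p \in l -> U p.1 x -> `|f x - ratr p.2| <= eta) ->
  (exists2 p, p \in l & U p.1 x) -> `|f x - step_path l x| <= eta.
Proof.
elim: l => [|p l IH] close_l [q] //=; rewrite inE => ql Uqx; case: ifPn => [|NUpx].
  by rewrite inE; apply: close_l; rewrite mem_head.
apply: IH => [p' p'l|]; first by apply: close_l; rewrite inE p'l orbT.
exists q => //; case/predU1P: ql Uqx NUpx => // -> Upx.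
by rewrite mem_set.
Qed.

Lemma continuous_step_path (f : X -> R) (eta : R) :
  0 < eta -> compact [set: X] -> continuous f ->
  exists l, forall x, `|f x - step_path l x| <= eta.
Proof.
move=> eta0 cX cf.
have /choice[g gP] x : exists p : nat * rat, [/\ open (U p.1), U p.1 x &
    forall y, U p.1 y -> `|f y - ratr p.2| <= eta].
  have [q] : exists q, ratr q \in `](f x - eta / 2), (f x + eta / 2)[.
    by apply: rat_in_itvoo; lra.
  rewrite in_itv/= => /andP[q1 q2].
  have /U_base[n [oU Ux Un]] : nbhs x [set y | `|f x - f y| < eta / 2].
    by apply: (@cvgr_dist_lt _ _ _ (nbhs x) _ f _ (cf x)); rewrite divr_gt0.
  exists (n, q); split => //= y /Un /=.
  rewrite !ltr_norml ler_norml => /andP[? ?].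
  by apply/andP; split; lra.
have [[x0 _]|X0] := pselect (exists x : X, True); last first.
  by exists [::] => x; exfalso; apply: X0; exists x.
have [F _ FX] : finite_subset_cover [set: X] (fun x => U (g x).1) [set: X].
  pose Y := HB.pack_for ptopologicalType (Topological.sort X)
    (isPointed.Build (Topological.sort X) x0).
  have : @cover_compact Y setT by rewrite -compact_cover.
  apply => [x _|x _]; first by have [] := gP x.
  by exists x => //; have [] := gP x.
exists [seq g x | x <- finmap.enum_fset F] => x.
apply: step_path_close => [p /mapP[y _ ->]|]; first by have [_ _] := gP y; exact.
have [y /= yF Uyx] := FX x Logic.I.
by exists (g y) => //; exact: map_f.
Qed.

End step_paths.

Lemma continuous_paths_seq_ball_gt0 (R : realType) (X : topologicalType)
    d (T : measurableType d) (P : probability T R) (Z : T -> X -> R)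
    (D : nat -> X) (eta : R) :
  @second_countable X -> compact [set: X] ->
  (forall t, measurable_fun [set: T] (Z ^~ t)) -> (forall x, continuous (Z x)) ->
  0 < eta -> exists g, (0 < P [set x | seq_ball D g eta (Z x)])%E.
Proof.
move=> /second_countable_base_seq[U U_base] cX mZ cZ eta0.
have [l Pl] : exists l, (0 < P [set x | seq_ball D (step_path U l) eta (Z x)])%E.
  apply: countable_cover_measure_gt0 => [l|x|]; last by rewrite [ltRHS]probability_setT.
    exact: measurable_seq_ball.
  have [l close_l] := continuous_step_path U_base eta0 cX (cZ x).
  by exists l => n; exact: close_l.
by exists (step_path U l).
Qed.

(** * Supremum distance on continuous paths *)

Lemma lte_EFin_subr_inv (R : realType) (x : \bar R) (e : R) :
  (x < e%:E)%E <-> exists n, (x <= (e - n.+1%:R^-1)%:E)%E.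
Proof.
split=> [|[n /le_lt_trans]]; last by apply; rewrite lte_fin ltrBlDr ltrDl invr_gt0.
case: x => [r| |] //; last by exists 0; rewrite leNye.
rewrite lte_fin -subr_gt0 => /ltr_add_invr[n]; rewrite add0r => n_lt.
by exists n; rewrite lee_fin lerBrDr -lerBrDl ltW.
Qed.

Section sup_distance.
Context {R : realType} {X : topologicalType} (D : nat -> X).
Hypothesis D_dense : dense (range D).
Variables s w : X -> R.
Hypotheses (cs : continuous s) (cw : continuous w).

Local Notation sup_dist := (ereal_sup (range (fun t => `|s t - w t|%:E))).

Lemma sup_dist_le (r : R) : (sup_dist <= r%:E)%E <-> seq_ball D w r s.
Proof.
split=> [sup_le n|ball_s].
  by rewrite -lee_fin (le_trans _ sup_le)//; apply: ereal_sup_ubound; exists (D n).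
apply: ge_ereal_sup => _ [t _ <-]; rewrite lee_fin.
apply: (@dense_range_le _ _ D (fun t => `|s t - w t|)) => // x.
by apply: cvg_norm; apply: cvgB; [exact: cs|exact: cw].
Qed.

Lemma sup_dist_lt (e : R) :
  (sup_dist < e%:E)%E <-> exists n, seq_ball D w (e - n.+1%:R^-1) s.
Proof.
by rewrite lte_EFin_subr_inv; split=> -[n] /sup_dist_le; exists n.
Qed.

End sup_distance.

(** * Functions in the closure of the kernel combinations *)

Section rkhs.
Context {R : realType}.

Section approximation.
Context {I : choiceType} (sigma : I -> I -> R).

Lemma rkhs_approx (f : I -> R) (e : R) : rkhs sigma f -> 0 < e ->
  exists a, forall t, `|f t - kernel_comb sigma a t| < e.
Proof.
move=> /rkhsP fP /fP[_ [k [a [u [_ ->]]]] fg].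
exists [seq (a i, u i) | i <- enum 'I_k] => t; rewrite -lte_fin.
by apply: le_lt_trans fg; apply: ereal_sup_ubound; exists t => //; rewrite -lincomb_ord.
Qed.

Lemma rkhs_subr_approx (f g : I -> R) (e : R) :
  rkhs sigma f -> rkhs sigma g -> 0 < e ->
  exists a, forall t, `|f t - g t - kernel_comb sigma a t| < e.
Proof.
move=> hf hg e0; have e2 : 0 < e / 2 by rewrite divr_gt0.
have [a fE] := rkhs_approx hf e2; have [b gE] := rkhs_approx hg e2.
exists (a ++ [seq (- 1 * p.1, p.2) | p <- b]) => t.
rewrite /kernel_comb lincomb_cat lincomb_scale mulN1r.
have := fE t; have := gE t; rewrite /kernel_comb !ltr_norml => /andP[? ?] /andP[? ?].
by apply/andP; split; lra.
Qed.

End approximation.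

Section continuity.
Context {I : topologicalType} (sigma : I -> I -> R).
Hypothesis sigma_continuous : continuous (fun st : (I * I)%type => sigma st.1 st.2).

Lemma kernel_comb_continuous a : continuous (kernel_comb sigma a).
Proof.
move=> t; apply: cvg_big => [|p _]; first exact: add_continuous.
apply: cvgM; first exact: cvg_cst.
have := @sigma_continuous (t, p.2).
apply: (cvg_comp (fun x => (x, p.2)) (fun st => sigma st.1 st.2)).
by apply: cvg_pair; [exact: cvg_id|exact: cvg_cst].
Qed.

Lemma rkhs_continuous (f : I -> R) : rkhs sigma f -> continuous f.
Proof.
move=> hf t; apply/cvgrPdist_lt => e e0.
have e3 : 0 < e / 3 by rewrite divr_gt0.
have [a fE] := rkhs_approx hf e3.
have := @kernel_comb_continuous a t.
move=> /cvgrPdist_lt /(_ _ e3); apply: filterS => s /=.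
have := fE t; have := fE s.
rewrite !ltr_norml => /andP[? ?] /andP[? ?] /andP[? ?].
by apply/andP; split; lra.
Qed.

End continuity.
End rkhs.

(** * Small balls of Gaussian processes *)

Section gaussian_seq_ball.
Context {R : realType} {I : topologicalType} d (Omega : measurableType d).
Variables (P : probability Omega R) (W : I -> {RV P >-> R}).
Variables (mu : I -> R) (sigma : I -> I -> R) (w : I -> R) (D : nat -> I).

Lemma gaussian_seq_ball_gt0 (r : R) :
  @second_countable I -> compact [set: I] ->
  gaussian_process W -> (forall x, continuous (W ^~ x)) ->
  has_mean W mu -> has_covariance W sigma -> rkhs sigma mu -> rkhs sigma w ->
  0 < r -> (0 < P [set x | seq_ball D w r (W ^~ x)])%E.
Proof.
move=> I_countable I_compact gW W_continuous mW cW mu_rkhs w_rkhs r0.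
have [r2 r4] : 0 < r / 2 /\ 0 < r / 4 by split; rewrite divr_gt0.
have [a close_a] := rkhs_subr_approx w_rkhs mu_rkhs r2.
apply: (kernel_shift_gt0 gW mW cW (a := a)); first exact: cylinder_seq_ball.
have [g ball_g] := continuous_paths_seq_ball_gt0 P D I_countable I_compact
  (fun t => measurable_funP (W t)) W_continuous r4.
apply: (lt_le_trans (seq_ball_mean_gt0 gW mW cW ball_g)).
apply: le_measure; rewrite ?inE.
- exact: measurable_seq_ball.
- apply: (@measurable_seq_ball _ _ _ _ (fun x t => W t x + kernel_comb sigma a t)) => t.
  exact: measurable_funD.
move=> x ball_x n; have := ball_x n; have := close_a (D n).
rewrite ltr_norml !ler_norml => /andP[? ?] /andP[? ?].
by apply/andP; split; lra.
Qed.

End gaussian_seq_ball.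

Theorem theorem4 (R : realType) (d : nat) (T : set 'rV[R]_d)
    (dO : measure_display) (Omega : measurableType dO)
    (P : probability Omega R) (W : T -> {RV P >-> R})
    (mu : T -> R) (sigma : T -> T -> R) (w : T -> R)
    (T_compact : compact T)
    (W_gaussian : gaussian_process W)
    (W_continuous : forall omega : Omega, continuous (fun t : T => W t omega))
    (W_mean : has_mean W mu)
    (W_covariance : has_covariance W sigma)
    (sigma_continuous :
       continuous (fun st : (T * T)%type => sigma st.1 st.2))
    (mu_rkhs : rkhs sigma mu)
    (w_rkhs : rkhs sigma w) :
  forall eps : R, 0 < eps ->
    (0 < P [set omega | ereal_sup (range (fun t : T => `|W t omega - w t|%:E))
                        < eps%:E])%E.
Proof.
move=> eps eps0.
have T_countable := compact_second_countable_set_type T_compact.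
have [[t0 _]|T0] := pselect (exists t : T, True); last first.
  rewrite (_ : [set _ | _] = setT) ?probability_setT//.
  apply/seteqP; split=> // x _ /=; apply: (@le_lt_trans _ _ -oo%E); last exact: ltNyr.
  by apply: ge_ereal_sup => y [t]; exfalso; apply: T0; exists t.
have [D D_dense] := second_countable_dense_seq t0 T_countable.
have w_continuous := rkhs_continuous sigma_continuous w_rkhs.
have sup_ltE x := sup_dist_lt D_dense (W_continuous x) w_continuous eps.
rewrite (_ : [set _ | _] = \bigcup_n
    [set x | seq_ball D w (eps - n.+1%:R^-1) (W ^~ x)]); last first.
  apply/seteqP; split=> [x /sup_ltE[n]|x [n _ ball_x]]; first by exists n.
  by apply/sup_ltE; exists n.
have [n] := ltr_add_invr eps0; rewrite add0r -subr_gt0 => radius_gt0.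
apply: lt_le_trans (gaussian_seq_ball_gt0 D T_countable (compact_set_type T_compact)
  W_gaussian W_continuous W_mean W_covariance mu_rkhs w_rkhs radius_gt0) _.
have mball k : measurable [set x | seq_ball D w (eps - k.+1%:R^-1) (W ^~ x)].
  exact: measurable_seq_ball.
by apply: le_measure; rewrite ?inE//; [exact: bigcupT_measurable|move=> x; exists n].
Qed.
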